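(* Let $G$ be a finitely generated group, let $\mathcal{E}$ be a conjugation-invariant class of subgroups of $G$, let $(H_i)$ be a (possibly empty) family of subgroups of $G$, and let $\sim$ be an equivalence relation on $\mathcal{E}$ that is admissible relative to the $H_i$'s. All $\mathcal{E}$-trees considered are minimal and such that each $H_i$ is elliptic in them. For an $\mathcal{E}$-tree $T$, let $T_c$ be its tree of cylinders. (1) $T_c$ depends only on the deformation space containing $T$: if $T,T'$ are $\mathcal{E}$-trees in the same deformation space, then there is a canonical $G$-equivariant isomorphism between $T_c$ and $T'_c$. (2) The assignment $T\mapsto T_c$ is functorial: every $G$-equivariant map $f:T\to T'$ between $\mathcal{E}$-trees induces a natural $G$-equivariant cellular map $f_c:T_c\to T'_c$ (that is, $f_c$ maps each vertex to a vertex and each edge to an edge or a vertex), compatibly with identities and compositions.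
   Context: Trees. A tree is a simplicial tree with an action of $G$ without inversions. It is minimal if it has no proper $G$-invariant subtree. $G_v,G_e$ denote stabilizers of vertices and edges. An $\mathcal{E}$-tree is a tree all of whose edge stabilizers belong to $\mathcal{E}$. A subgroup of $G$ is elliptic in $T$ if it fixes a point of $T$. Two trees are in the same deformation space if they have the same elliptic subgroups. Equivariant maps between trees are assumed to send vertices to vertices and each edge to a point or an edge path. Admissible relation. Write $A^g=g^{-1}Ag$. An equivalence relation $\sim$ on $\mathcal{E}$ is admissible relative to the $H_i$'s if for all $A,B\in\mathcal{E}$: (i) if $A\sim B$ and $g\in G$, then $A^g\sim B^g$; (ii) if $A\subset B$, then $A\sim B$; (iii) for every $\mathcal{E}$-tree $T$ in which each $H_i$ is elliptic, if $A\sim B$ and $A,B$ fix $a,b\in T$ respectively, then $G_e\sim A\sim B$ for every edge $e\subset[a,b]$. (If the family $(H_i)$ is empty one just says admissible.) Tree of cylinders. Let $T$ be an $\mathcal{E}$-tree in which each $H_i$ is elliptic. Declare two edges $e,e'$ of $T$ equivalent if $G_e\sim G_{e'}$. A cylinder of $T$ is an equivalence class $Y$ of edges, identified with the union of its edges; cylinders are subtrees of $T$ and two distinct cylinders meet in at most one point. The tree of cylinders $T_c$ is the bipartite tree with vertex set $V_0(T_c)\sqcup V_1(T_c)$, where $V_0(T_c)$ is the set of vertices of $T$ belonging to at least two distinct cylinders, $V_1(T_c)$ is the set of cylinders of $T$, and there is an edge $(x,Y)$ between $x\in V_0(T_c)$ and $Y\in V_1(T_c)$ if and only if $x\in Y$.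 It carries the induced $G$-action. If $T$ is a single point, $T_c$ is understood to be a point. *)

(* Defs.v *)
From HB Require Import structures.
From mathcomp Require Import ssreflect ssrfun ssrbool eqtype ssrnat seq monoid.
From mathcomp Require Import boolp classical_sets.

Set Implicit Arguments.
Unset Strict Implicit.
Unset Printing Implicit Defensive.

Local Open Scope classical_set_scope.
Local Open Scope group_scope.

Section Subgroups.
Context {G : groupType}.

Definition subgroup (A : set G) : Prop :=
  [/\ A 1, forall x y, A x -> A y -> A (x * y) & forall x, A x -> A x^-1].

Definition finitely_generated : Prop :=
  exists s : seq G, forall A : set G,
    subgroup A -> (forall x, x \in s -> A x) -> A = setT.

(* [x ^ g] is [g^-1 * (x * g)]. *)
Definition conjset (A : set G) (g : G) : set G := [set x ^ g | x in A].

Definition subgroup_class (E : set (set G)) : Prop :=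
  forall A, E A -> subgroup A.

Definition conj_invariant (E : set (set G)) : Prop :=
  forall A g, E A -> E (conjset A g).

End Subgroups.
Arguments finitely_generated G : clear implicits.

(* An edge path is given by its initial vertex [u] and the sequence [s] of its
   subsequent vertices. *)
Section Walks.
Context {X : Type}.

Fixpoint walk (r : X -> X -> Prop) (u : X) (s : seq X) : Prop :=
  if s is w :: s' then r u w /\ walk r w s' else True.

Fixpoint reduced (u : X) (s : seq X) : Prop :=
  if s is w :: s' then
    (if s' is z :: _ then u <> z else True) /\ reduced w s'
  else True.

Fixpoint traverses (u : X) (s : seq X) (e : X * X) : Prop :=
  if s is w :: s' then e = (u, w) \/ traverses w s' e else False.

End Walks.

(* Simplicial trees have neither loops nor multiple edges, so a G-graph is a
   simple graph: an edge is an adjacent pair of vertices, and an oriented edge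
   is an ordered such pair. *)
Record Ggraph (G : groupType) := {
  vertex :> Type;
  adj : vertex -> vertex -> Prop;
  act : G -> vertex -> vertex;
  adj_irr : forall u, ~ adj u u;
  adj_sym : forall u w, adj u w -> adj w u;
  act1 : forall u, act 1 u = u;
  actM : forall g h u, act (g * h) u = act g (act h u);
  adj_act : forall g u w, adj u w -> adj (act g u) (act g w)
}.

Section Graphs.
Context {G : groupType}.
Implicit Types X Y : Ggraph G.

Definition is_tree X : Prop :=
  [/\ exists u : X, True,
      forall u v : X, exists s, walk (@adj G X) u s /\ last u s = v
    & forall (u : X) s s', walk (@adj G X) u s -> reduced u s ->
        walk (@adj G X) u s' -> reduced u s' -> last u s = last u s' -> s = s'].

Definition without_inversions X : Prop :=
  forall (u w : X) g, adj u w -> ~ (act g u = w /\ act g w = u).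

(* In a tree, a subtree is determined by its (nonempty) set of vertices. *)
Definition subtree X (S : set X) : Prop :=
  S !=set0 /\
  forall u v, S u -> S v -> exists s,
    walk (fun x y => adj x y /\ S y) u s /\ last u s = v.

Definition minimal X : Prop :=
  forall S : set X, subtree S -> (forall g x, S x -> S (act g x)) -> S = setT.

(* In the absence of inversions, the stabilizer of an edge fixes its two
   endpoints, and a subgroup fixing an interior point of an edge fixes its
   endpoints; so edge stabilizers and fixed points are read off the vertices. *)
Definition fixes X (A : set G) (v : X) : Prop := forall g, A g -> act g v = v.

Definition edge_stab X (e : X * X) : set G :=
  [set g | act g e.1 = e.1 /\ act g e.2 = e.2].

Definition elliptic X (A : set G) : Prop := exists v : X, fixes A v.

Definition same_deformation_space X Y : Prop :=
  forall A : set G, subgroup A -> (elliptic X A <-> elliptic Y A).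

Definition equivariant X Y (phi : X -> Y) : Prop :=
  forall g x, phi (act g x) = act g (phi x).

Definition cellular X Y (phi : X -> Y) : Prop :=
  forall u w, adj u w -> adj (phi u) (phi w) \/ phi u = phi w.

Definition graph_iso X Y (phi : X -> Y) : Prop :=
  bijective phi /\ forall u w, adj u w <-> adj (phi u) (phi w).

End Graphs.

Section Trees.
Context {G : groupType} (E : set (set G)) {I : Type} (H : I -> set G).

Record Gtree := {
  Gtree_graph :> Ggraph G;
  Gtree_tree : is_tree Gtree_graph;
  Gtree_noinv : without_inversions Gtree_graph
}.

Definition Etree (X : Ggraph G) : Prop :=
  forall u w : X, adj u w -> E (edge_stab (u, w)).

Definition rel_elliptic (X : Ggraph G) : Prop := forall i, elliptic X (H i).

Record minimal_Etree := {
  minimal_Etree_tree :> Gtree;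
  minimal_Etree_E : Etree minimal_Etree_tree;
  minimal_Etree_H : rel_elliptic minimal_Etree_tree;
  minimal_Etree_min : minimal minimal_Etree_tree
}.

(* Only the values of [R] on members of [E] are meaningful. *)
Record admissible (R : set G -> set G -> Prop) : Prop := {
  adm_refl : forall A, E A -> R A A;
  adm_sym : forall A B, E A -> E B -> R A B -> R B A;
  adm_trans : forall A B C, E A -> E B -> E C -> R A B -> R B C -> R A C;
  adm_conj : forall A B g, E A -> E B -> R A B -> R (conjset A g) (conjset B g);
  adm_sub : forall A B, E A -> E B -> A `<=` B -> R A B;
  adm_segment : forall (T : Gtree) A B (a b : T) (s : seq T) (e : T * T),
    Etree T -> rel_elliptic T -> E A -> E B -> R A B ->
    fixes A a -> fixes B b ->
    walk (@adj G T) a s -> reduced a s -> last a s = b -> traverses a s e ->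
    R (edge_stab e) A /\ R (edge_stab e) B
}.

End Trees.
Arguments Gtree G : clear implicits.

(* Maps between trees: vertices go to vertices and the oriented edge (u, w)
   goes to the edge path starting at [emap_vertex u] with subsequent vertices
   [emap_path u w] (empty if the edge is collapsed), which need not be reduced.
   The values of [emap_path] on non-adjacent pairs are irrelevant. *)
Record emap (G : groupType) (X Y : Ggraph G) := {
  emap_vertex :> X -> Y;
  emap_path : X -> X -> seq Y;
  emap_equiv : equivariant emap_vertex;
  emap_walk : forall u w, adj u w ->
    walk (@adj G Y) (emap_vertex u) (emap_path u w);
  emap_last : forall u w, adj u w ->
    last (emap_vertex u) (emap_path u w) = emap_vertex w;
  emap_rev : forall u w, adj u w ->
    emap_vertex w :: emap_path w u = rev (emap_vertex u :: emap_path u w);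
  emap_path_equiv : forall g u w, adj u w ->
    emap_path (act g u) (act g w) = map (act g) (emap_path u w)
}.

Section Maps.
Context {G : groupType}.

Definition emap_id (X : Ggraph G) : emap X X.
Proof.
exists (fun u => u) (fun _ w => [:: w]) => //.
Defined.

Section Comp.
Context {X Y Z : Ggraph G} (g : emap Y Z) (f : emap X Y).

Fixpoint map_path (u : Y) (s : seq Y) : seq Z :=
  if s is w :: s' then emap_path g u w ++ map_path w s' else [::].

Lemma walk_cat (W : Ggraph G) (u : W) s t :
  walk (@adj G W) u s -> walk (@adj G W) (last u s) t ->
  walk (@adj G W) u (s ++ t).
Proof. by elim: s u => //= w s IH u [uw ws] /(IH _ ws). Qed.

Lemma map_path_last u s : walk (@adj G Y) u s ->
  last (g u) (map_path u s) = g (last u s).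
Proof.
by elim: s u => //= w s IH u [uw ws]; rewrite last_cat emap_last // IH.
Qed.

Lemma map_path_walk u s : walk (@adj G Y) u s ->
  walk (@adj G Z) (g u) (map_path u s).
Proof.
elim: s u => //= w s IH u [uw ws]; apply: walk_cat; first exact: emap_walk.
by rewrite emap_last //; apply: IH.
Qed.

Lemma map_path_cat u s t :
  map_path u (s ++ t) = map_path u s ++ map_path (last u s) t.
Proof. by elim: s u => //= w s IH u; rewrite IH catA. Qed.

Lemma map_path_rev u s v t : walk (@adj G Y) u s -> v :: t = rev (u :: s) ->
  g v :: map_path v t = rev (g u :: map_path u s).
Proof.
elim: s u v t => [|w s IH] u v t /=; first by move=> _ [-> ->].
move=> [uw ws]; rewrite rev_cons.
case E: (rev (w :: s)) => [|v' t'].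
  by have := size_rev (w :: s); rewrite E.
move=> [-> ->]; have ev := IH _ _ _ ws (esym E).
have lt : last v' t' = w.
  by have := congr1 (last w) E; rewrite rev_cons last_rcons.
rewrite -cats1 map_path_cat /= cats0 lt -cat_cons ev -[in RHS]cat_cons rev_cat.
by rewrite -(emap_rev g uw) rev_cons cat_rcons.
Qed.

Lemma map_path_equiv h u s : walk (@adj G Y) u s ->
  map_path (act h u) (map (act h) s) = map (act h) (map_path u s).
Proof.
by elim: s u => //= w s IH u [uw ws]; rewrite map_cat emap_path_equiv // IH.
Qed.

Definition emap_comp : emap X Z.
Proof.
exists (fun u => g (f u)) (fun u w => map_path (f u) (emap_path f u w)).
- by move=> h x; rewrite !emap_equiv.
- by move=> u w uw; apply/map_path_walk/emap_walk.
- by move=> u w uw; rewrite map_path_last ?emap_last //; apply: emap_walk.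
- by move=> u w uw; apply: map_path_rev; [apply: emap_walk|apply: emap_rev].
- move=> h u w uw; rewrite emap_path_equiv // emap_equiv map_path_equiv //.
  exact: emap_walk.
Defined.

End Comp.
End Maps.

Section Cylinders.
Context {G : groupType} (R : set G -> set G -> Prop) (X : Ggraph G).

Definition edge_class (e : X * X) : set (X * X) :=
  [set e' | adj e'.1 e'.2 /\ R (edge_stab e) (edge_stab e')].

(* A cylinder is a set of edges, each listed with its two orientations (which
   have the same stabilizer). *)
Definition is_cylinder (Y : set (X * X)) : Prop :=
  exists e, adj e.1 e.2 /\ Y = edge_class e.

Definition cylinder : Type := {Y : set (X * X) | is_cylinder Y}.

Definition in_cylinder (x : X) (Y : set (X * X)) : Prop :=
  exists w, Y (x, w).

(* The second alternative occurs only for a tree reduced to a point, which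
   makes its tree of cylinders a point. *)
Definition is_V0 (x : X) : Prop :=
  (exists Y Y' : set (X * X),
     [/\ is_cylinder Y, is_cylinder Y', Y <> Y',
         in_cylinder x Y & in_cylinder x Y'])
  \/ (forall u w : X, ~ adj u w).

Definition V0 : Type := {x : X | is_V0 x}.

Definition act_edges (g : G) (Y : set (X * X)) : set (X * X) :=
  [set (act g e.1, act g e.2) | e in Y].

Lemma act_edges1 Y : act_edges 1 Y = Y.
Proof.
apply/seteqP; split => [_ [[u w] Yuw <-]|[u w] Yuw]; rewrite /= ?act1 //.
by exists (u, w) => //=; rewrite !act1.
Qed.

Lemma act_edgesM g h Y : act_edges (g * h) Y = act_edges g (act_edges h Y).
Proof.
apply/seteqP; split => [_ [[u w] Yuw <-]|_ [_ [[u w] Yuw <-] <-]] /=.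
  by exists (act h u, act h w); rewrite /= ?actM //; exists (u, w).
by exists (u, w) => //=; rewrite !actM.
Qed.

Lemma actK g : cancel (@act G X g) (act g^-1).
Proof. by move=> u; rewrite -actM mulVg act1. Qed.

Lemma actVK g : cancel (@act G X g^-1) (act g).
Proof. by move=> u; rewrite -actM mulgV act1. Qed.

Lemma in_cylinder_act g x Y :
  in_cylinder x Y -> in_cylinder (act g x) (act_edges g Y).
Proof. by case=> w Yxw; exists (act g w), (x, w). Qed.

Lemma edge_stab_act g (e : X * X) :
  edge_stab (act g e.1, act g e.2) = conjset (edge_stab e) g^-1.
Proof.
apply/seteqP; split => [h [/= h1 h2]|_ [h [h1 h2] <-]].
  exists (h ^ g); last by rewrite -conjgM mulgV conjg1.
  by split; rewrite conjgE !actM (h1, h2) actK.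
by split; rewrite /= conjgE invgK !actM actK (h1, h2).
Qed.

End Cylinders.

Section TreeOfCylinders.
Context {G : groupType} {E : set (set G)} {I : Type} {H : I -> set G}.
Context {R : set G -> set G -> Prop} (adm : admissible E H R).
Context (T : minimal_Etree E H).

Lemma edge_class_act_sub g (e : T * T) : adj e.1 e.2 ->
  act_edges g (edge_class R e) `<=` edge_class R (act g e.1, act g e.2).
Proof.
move=> ae _ [[u w] [/= auw Ruw] <-]; split; first exact: adj_act.
rewrite edge_stab_act (edge_stab_act g (u, w)).
apply: (adm_conj adm) Ruw; last exact: minimal_Etree_E.
by case: e ae => ? ? /minimal_Etree_E.
Qed.

Lemma edge_class_act g (e : T * T) : adj e.1 e.2 ->
  act_edges g (edge_class R e) = edge_class R (act g e.1, act g e.2).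
Proof.
move=> ae; apply/seteqP; split; first exact: edge_class_act_sub.
rewrite -[X in X `<=` _](act_edges1 (X := T)) -(mulgV g) act_edgesM.
move=> _ [e' /edge_class_act_sub Pe' <-]; exists e' => //.
have := Pe' (adj_act g ae); rewrite /= !actK.
by case: e ae {Pe'}.
Qed.

Lemma is_cylinder_act g (Y : set (T * T)) :
  is_cylinder R Y -> is_cylinder R (act_edges g Y).
Proof.
case=> e [ae ->]; exists (act g e.1, act g e.2).
by split; [apply: adj_act | rewrite edge_class_act].
Qed.

Lemma is_V0_act g (x : T) : is_V0 R x -> is_V0 R (act g x).
Proof.
case=> [[Y [Y' [cY cY' YY' xY xY']]]|]; last by right.
left; exists (act_edges g Y), (act_edges g Y').
split; [exact: is_cylinder_act | exact: is_cylinder_act | | |];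
  try exact: in_cylinder_act.
move=> /(congr1 (act_edges g^-1)).
by rewrite -!act_edgesM mulVg !act_edges1.
Qed.

Definition Tc_vertex : Type := (V0 R T + cylinder R T)%type.

Definition Tc_adj (a b : Tc_vertex) : Prop :=
  match a, b with
  | inl x, inr Y => in_cylinder (sval x) (sval Y)
  | inr Y, inl x => in_cylinder (sval x) (sval Y)
  | _, _ => False
  end.

Definition Tc_act (g : G) (a : Tc_vertex) : Tc_vertex :=
  match a with
  | inl x => inl (exist _ (act g (sval x)) (is_V0_act g (svalP x)))
  | inr Y => inr (exist _ (act_edges g (sval Y)) (is_cylinder_act g (svalP Y)))
  end.

Definition Tc : Ggraph G.
Proof.
exists Tc_vertex Tc_adj Tc_act.
- by case=> ? [].
- by case=> [x|Y] [x'|Y'].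
- case=> [[x ?]|[Y ?]] /=; congr (_ _); apply: eq_exist;
    by rewrite ?act1 ?act_edges1.
- move=> g h [[x ?]|[Y ?]] /=; congr (_ _); apply: eq_exist;
    by rewrite ?actM ?act_edgesM.
- by move=> g [x|Y] [x'|Y'] //=; apply: in_cylinder_act.
Defined.

End TreeOfCylinders.

(* [fc] is the map induced by [f] on points and cylinders viewed as subsets:
   [fc x] is the point f(x), and [fc Y] is f(Y), which is either a point or a
   cylinder. *)
Definition induced_by (G : groupType) (E : set (set G)) (I : Type)
    (H : I -> set G) (R : set G -> set G -> Prop) (adm : admissible E H R)
    (T T' : minimal_Etree E H) (f : emap T T') (fc : Tc adm T -> Tc adm T') :
    Prop :=
  (forall x : V0 R T, exists x' : V0 R T',
     fc (inl x) = inl x' /\ sval x' = f (sval x)) /\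
  (forall Y : cylinder R T,
     match fc (inr Y) with
     | inl x' => forall u w, sval Y (u, w) ->
         f u = sval x' /\ emap_path f u w = [::]
     | inr Y' => forall e', sval Y' e' <->
         exists u w, sval Y (u, w) /\ traverses (f u) (emap_path f u w) e'
     end).

(* Main.v *)
Require Import Defs.
From mathcomp Require Import ssreflect ssrfun ssrbool eqtype ssrnat seq monoid.
From mathcomp Require Import boolp classical_sets.

(* Let f : T -> T' be equivariant. An edge traversed by f(e) has a stabilizer
   containing G_e, hence equivalent to it; as f is onto by minimality of T',
   the image of a cylinder is a cylinder or a point. If f collapses the cylinder
   of an edge e at x, then each of the two half-trees at e contains an edge that
   is not collapsed (by minimality of T, a half-tree contains a translate of
   every vertex). The first such edges on the two sides are not equivalent,
   since e separates them, so f(x) lies on two cylinders. This gives f_c.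
   Two equivariant maps agree on V_0: if G_x fixed two points of T', it would
   fix an edge, whose stabilizer would be equivalent to those of all edges at x.
   In particular, if T and T' are in the same deformation space, so that there
   is also a map T' -> T, the composite T -> T' -> T is the identity on V_0.
   Since a cylinder has two points in V_0 or contains all the edges of T, f then
   collapses no cylinder unless T' is a point, and f_c does not depend on f. *)

Local Open Scope classical_set_scope.
Local Open Scope group_scope.

(** * Walks, reduced walks and connectedness for a relation *)

Section Walk.
Set Implicit Arguments.
Unset Strict Implicit.
Context {X : Type}.
Implicit Types (r : X -> X -> Prop) (u v w : X) (s t : seq X).

Definition conn r u v : Prop := exists s, walk r u s /\ last u s = v.

Lemma walkP r u s :
  walk r u s <-> forall e, traverses u s e -> r e.1 e.2.
Proof.
elim: s u => //= w s IH u; split=> [[ruw ws] e [->//|]|rs].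
  by move/IH: ws; apply.
by split; [apply: (rs (u, w)); left | apply/IH => e es; apply: rs; right].
Qed.

Lemma walk_mono r r' u s :
  (forall a b, r a b -> r' a b) -> walk r u s -> walk r' u s.
Proof. by move=> rr' /walkP ws; apply/walkP => e /ws /rr'. Qed.

Lemma walk_catP r u s t :
  walk r u (s ++ t) <-> walk r u s /\ walk r (last u s) t.
Proof.
elim: s u => [|w s IH] u /=; first by split=> [|[]].
split=> [[ruw /IH[]]|[[ruw ws] wt]]; first by [].
by split=> //; apply/IH.
Qed.

Lemma walk_stable r (P : X -> Prop) u s : walk r u s -> P u ->
  (forall a b, r a b -> P a -> P b) -> walk (fun a b => r a b /\ P b) u s.
Proof.
move=> ws Pu Pr; elim: s u ws Pu => //= w s IH u [uw ws] /(Pr _ _ uw) Pw.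
by split=> //; apply: IH.
Qed.

Lemma conn_refl r u : conn r u u.
Proof. by exists [::]. Qed.

Lemma conn_trans r u v w : conn r u v -> conn r v w -> conn r u w.
Proof.
move=> [s [ws <-]] [t [wt <-]]; exists (s ++ t).
by split; [apply/walk_catP | rewrite last_cat].
Qed.

Lemma conn1 r u v : r u v -> conn r u v.
Proof. by move=> ruv; exists [:: v]. Qed.

(** The inductive step may use that [a] is reachable from [u]. When [r] is adjacency away from an
    edge, this places [a] in a half-tree. *)
Lemma conn_ind r (P : X -> Prop) u v : conn r u v -> P u ->
  (forall a b, conn r u a -> r a b -> P a -> P b) -> P v.
Proof.
move=> [s [ws <-]] Pu Pr.
suff H a : walk r a s -> conn r u a -> P a -> P (last a s).
  by apply: H => //; apply: conn_refl.
elim: s a {ws} => [//|w s IH] a /= [aw ws] ua Pa.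
by apply: IH => //; [apply: conn_trans ua (conn1 aw)|apply: Pr aw Pa].
Qed.

Lemma conn_sym r u v : (forall a b, r a b -> r b a) -> conn r u v -> conn r v u.
Proof.
move=> rC uv; apply: (conn_ind (P := fun a => conn r a u) uv); first exact: conn_refl.
by move=> a b _ /rC /conn1 ba /(conn_trans ba).
Qed.

Lemma conn_reduced r u v : conn r u v ->
  exists s, [/\ walk r u s, reduced u s & last u s = v].
Proof.
case=> s [ws <-]; elim: s u ws => [|w s IH] u /=; first by exists [::].
case=> ruw /IH[[|z t] [/= wt rt lt]]; first by exists [:: w]; rewrite /= -lt.
case: (pselect (u = z)) => [->|uz].
  by exists t; split=> //; [case: wt|case: rt].
by exists (w :: z :: t).
Qed.

Lemma traverses_exit r (P : X -> Prop) u s : walk r u s -> P u ->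
  ~ P (last u s) -> exists e, [/\ traverses u s e, r e.1 e.2, P e.1 & ~ P e.2].
Proof.
elim: s u => [//|w s IH] u /= [ruw ws] Pu Pl.
case: (pselect (P w)) => [/(IH _ ws)/(_ Pl)[e [es re P1 P2]]|nPw].
  by exists e; split=> //; right.
by exists (u, w); split=> //; left.
Qed.

Lemma traverses_map {Z : Type} (h : X -> Z) u s e :
  traverses (h u) (map h s) e <->
  exists2 e0, traverses u s e0 & e = (h e0.1, h e0.2).
Proof.
elim: s u => [|w s IH] u /=; first by split=> // -[].
split=> [[->|/IH[e0 e0s ->]]|[e0 [->|e0s] ee]]; first by exists (u, w) => //; left.
- by exists e0 => //; right.
- by left.
- by right; apply/IH; exists e0.
Qed.

Lemma walk_rev r u s : (forall a b, r a b -> r b a) -> walk r u s ->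
  exists t, [/\ rev (u :: s) = last u s :: t, walk r (last u s) t
              & last (last u s) t = u].
Proof.
move=> rC; elim: s u => [|w s IH] u /=; first by exists [::].
case=> ruw /IH[t [ts wt lt]]; exists (rcons t u); split.
- by rewrite rev_cons ts.
- by rewrite -cats1; apply/walk_catP; rewrite lt /=; split=> //; split=> //; apply: rC.
- by rewrite last_rcons.
Qed.

Lemma reduced_rcons u s a b :
  reduced u (rcons s a) -> last u s <> b -> reduced u (rcons (rcons s a) b).
Proof.
elim: s u => [|w s IH] u //= [uw rs] lb.
by split; [case: s {IH lb rs} uw|apply: IH].
Qed.

Lemma reduced_rev u s v t : rev (u :: s) = v :: t -> reduced u s -> reduced v t.
Proof.
elim: s u v t => [|w s IH] u v t; first by move=> [_ <-].
rewrite rev_cons; case Es: (rev (w :: s)) => [|v1 t1].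
  by have := size_rev (w :: s); rewrite Es.
move=> [<- <-] /= [uz rs]; have := IH _ _ _ Es rs.
case: s uz Es {IH rs} => [|z s] uz; first by case=> _ <-.
rewrite rev_cons; case Ez: (rev (z :: s)) => [|v2 t2].
  by have := size_rev (z :: s); rewrite Ez.
move=> [<- <-] rt; apply: reduced_rcons => // lu; apply: uz.
by have := congr1 (last u) Ez; rewrite rev_cons last_rcons /= lu.
Qed.

Lemma reduced_map {Z : Type} (h : X -> Z) u s :
  injective h -> reduced u s -> reduced (h u) (map h s).
Proof.
move=> hI; elim: s u => //= w s IH u [uz rs]; split; last exact: IH.
by case: s uz {IH rs} => //= z s uz /hI.
Qed.

Lemma walk_map {Z : Type} (h : X -> Z) r (r' : Z -> Z -> Prop) u s :
  (forall a b, r a b -> r' (h a) (h b)) -> walk r u s ->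
  walk r' (h u) (map h s).
Proof. by move=> hr; elim: s u => //= w s IH u [/hr ? /IH]. Qed.

End Walk.

(** * Geodesics in trees and their stabilizers *)

Section Tree.
Set Implicit Arguments.
Unset Strict Implicit.

Lemma conn_map {X Z : Type} (h : X -> Z) (r : X -> X -> Prop) (r' : Z -> Z -> Prop) u v :
  (forall a b, r a b -> r' (h a) (h b)) -> conn r u v -> conn r' (h u) (h v).
Proof.
move=> hr [s [ws <-]]; exists (map h s); rewrite last_map.
by split=> //; apply: walk_map ws.
Qed.

Context {G : groupType}.
Implicit Types X Y : Ggraph G.

Lemma act_inj X g : injective (@act G X g).
Proof. exact: can_inj (actK _). Qed.

Lemma adj_actP X g (u w : X) : adj (act g u) (act g w) <-> adj u w.
Proof. by split=> [/(adj_act g^-1)|/(adj_act g)//]; rewrite !actK. Qed.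

Lemma edge_stabC X (u w : X) : edge_stab (u, w) = edge_stab (w, u).
Proof. by apply/seteqP; split=> g []. Qed.

Lemma tree_conn X (u v : X) : is_tree X -> conn (@adj G X) u v.
Proof. by case=> _ + _; apply. Qed.

Lemma tree_reduced X (u v : X) : is_tree X ->
  exists s, [/\ walk (@adj G X) u s, reduced u s & last u s = v].
Proof. by move=> tX; apply/conn_reduced/tree_conn. Qed.

(** An [r]-walk between the two ends can be reduced, and by uniqueness of reduced walks the result
    is [s]. *)
Lemma reduced_walk_sub X r (u : X) s : is_tree X ->
  (forall a b, r a b -> adj a b) -> walk (@adj G X) u s -> reduced u s ->
  conn r u (last u s) -> walk r u s.
Proof.
case=> _ _ tX rX ws rs cu.
have [t [wt rt lt]] := conn_reduced cu.
by have <- : t = s by apply: (tX u) => //; apply: walk_mono wt.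
Qed.

(** A single edge is a geodesic, so a subgraph connecting its two ends must contain it. *)
Lemma conn_edge X r (a b : X) : is_tree X ->
  (forall a b, r a b -> adj a b) -> adj a b -> conn r a b -> r a b.
Proof.
move=> tX rX ab rab.
by have [] : walk r a [:: b] by apply: reduced_walk_sub.
Qed.

(** The translate by [g] is a reduced walk with the same ends, so it is the same walk. *)
Lemma reduced_walk_fixed X (u v : X) s g : is_tree X ->
  walk (@adj G X) u s -> reduced u s -> last u s = v ->
  act g u = u -> act g v = v -> map (act g) s = s.
Proof.
move=> [_ _ tX] ws rs ls gu gv.
apply: (tX u) => //; last by rewrite -[in LHS]gu last_map ls gv.
  by rewrite -gu; apply: walk_map ws => a b; apply: adj_act.
by rewrite -gu; apply: reduced_map rs; apply: act_inj.
Qed.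

Lemma traverses_fixed X (u : X) s g e : act g u = u -> map (act g) s = s ->
  traverses u s e -> edge_stab e g.
Proof.
elim: s u => //= w s IH u gu [gw gs] [->|]; [by split | exact: IH].
Qed.

Lemma adj_connected_all X (P : X -> Prop) u : is_tree X -> P u ->
  (forall a b, adj a b -> P a -> P b) -> forall v, P v.
Proof.
by move=> tX Pu Pa v; apply: (conn_ind (tree_conn u v tX)) => // a b _; apply: Pa.
Qed.

Lemma no_edge_point X : is_tree X -> (forall u w : X, ~ adj u w) ->
  forall u v : X, u = v.
Proof.
by move=> tX nadj u; apply: adj_connected_all => // a b /nadj.
Qed.

(** * Half-trees of an edge and the use of minimality *)

Section HalfTree.
Context {X : Ggraph G} (tX : is_tree X).
Implicit Types (x y u v : X).

Definition cut x y a b : Prop :=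
  [/\ adj a b, (a, b) <> (x, y) & (a, b) <> (y, x)].

(** The component of [y] once the edge is removed; that of [x] is [half_tree y x]. *)
Definition half_tree x y : set X := [set v | conn (cut x y) y v].

Lemma cut_sym x y a b : cut x y a b -> cut x y b a.
Proof.
by move=> [ab xy yx]; split; [exact: adj_sym|move=> [? ?]; apply: yx; congr (_, _)
  |move=> [? ?]; apply: xy; congr (_, _)].
Qed.

Lemma cutC x y a b : cut x y a b -> cut y x a b.
Proof. by case. Qed.

Lemma half_tree_src x y : adj x y -> ~ half_tree x y x.
Proof.
move=> xy h; have [] // : cut x y y x.
by apply: conn_edge h => // [a b []|] //; apply: adj_sym.
Qed.

Lemma half_exit x y a b : adj a b -> half_tree x y a ->
  half_tree x y b \/ (a, b) = (y, x).
Proof.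
move=> ab ha; case: (pselect ((a, b) = (y, x))) => [|ne]; [by right|left].
case: (pselect ((a, b) = (x, y))) => [[_ ->]|ne']; first exact: conn_refl.
by apply: conn_trans ha (conn1 _).
Qed.

Lemma half_disjoint x y v : adj x y -> half_tree x y v -> ~ half_tree y x v.
Proof.
move=> xy hv hv'; apply: (half_tree_src xy); apply: conn_trans hv _.
apply: conn_sym; first exact: cut_sym.
by case: hv' => s [ws ls]; exists s; split=> //; apply: walk_mono ws => a b /cutC.
Qed.

Lemma half_cover x y v : half_tree x y v \/ half_tree y x v.
Proof.
move: v; apply: (adj_connected_all (u := y) tX); first by left; apply: conn_refl.
move=> a b ab [] /(half_exit ab)[|[_ ->]].
- by left.
- by right; apply: conn_refl.
- by right.
- by left; apply: conn_refl.
Qed.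

Lemma half_crossing x y u s : adj x y -> walk (@adj G X) u s ->
  half_tree x y u -> half_tree y x (last u s) -> traverses u s (y, x).
Proof.
move=> xy ws hu hl.
have [|[a b] [es ab /= ha hb]] := traverses_exit (P := half_tree x y) ws hu.
  by move=> /(half_disjoint xy).
by have [//|[<- <-]] := half_exit ab ha.
Qed.

Lemma cut_act x y g a b :
  cut x y a b <-> cut (act g x) (act g y) (act g a) (act g b).
Proof.
split=> -[ab xy yx]; split; try exact/adj_actP.
- by move=> [/act_inj ax /act_inj by_]; apply: xy; rewrite ax by_.
- by move=> [/act_inj ax /act_inj by_]; apply: yx; rewrite ax by_.
- by apply/(adj_actP g).
- by move=> [ax by_]; apply: xy; rewrite ax by_.
- by move=> [ax by_]; apply: yx; rewrite ax by_.
Qed.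

(* If no translate of [v] lay beyond the edge, the hull of the orbit of [v]
   would avoid all translates of that edge. *)
Lemma half_translate x y v : minimal X -> adj x y ->
  exists g, half_tree x y (act g v).
Proof.
move=> mX xy; apply: contrapT => /forallNP nh.
have hv g : half_tree y x (act g v) by case: (half_cover x y (act g v)) => // /nh.
(* Adjacency after removal of every translate of the edge. *)
pose r a b := forall k, cut (act k x) (act k y) a b.
have rX a b : r a b -> adj a b by move=> /(_ 1)[].
have rC a b : r a b -> r b a by move=> rab k; apply: cut_sym.
have r_act g a b : r a b -> r (act g a) (act g b).
  move=> rab k; apply/(cut_act _ _ g^-1); rewrite !actK -!actM.
  exact: rab.
have orb g h : conn r (act g v) (act h v).
  have [s [ws rs ls]] := tree_reduced (act g v) (act h v) tX.
  exists s; split=> //; apply/walkP => e es k.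
  suff /walkP : walk (cut (act k x) (act k y)) (act g v) s by apply.
  apply: reduced_walk_sub => // [a b []//|].
  (* Translating by [k^-1] reduces to the edge itself: both orbit points then lie in
     [half_tree y x], which is connected without that edge. *)
  have : conn (cut x y) (act (k^-1 * g) v) (act (k^-1 * h) v).
    apply: conn_trans (conn_sym (@cut_sym _ _) _) _.
    - case: (hv (k^-1 * g)) => t [wt lt]; exists t; split; last exact: lt.
      by apply: walk_mono wt => a b /cutC.
    - case: (hv (k^-1 * h)) => t [wt lt]; exists t; split; last exact: lt.
      by apply: walk_mono wt => a b /cutC.
  rewrite ls => /(conn_map (h := act k) (fun a b => (cut_act x y k a b).1)).
  by rewrite -!actM !mulVKg.
pose S : set X := [set z | exists g, conn r (act g v) z].
have ST : S = setT.
  apply: mX => [|g z [h hz]].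
    split; first by exists (act 1 v), 1; apply: conn_refl.
    move=> a b [g ga] [h hb].
    have [s [ws ls]] : conn r a b.
      by apply: conn_trans (conn_sym rC ga) (conn_trans (orb g h) hb).
    exists s; split=> //; apply: (@walk_mono _ (fun c d => r c d /\ S d)).
      by move=> c d [/rX].
    apply: walk_stable ws _ _; first by exists g.
    by move=> c d cd [k kc]; exists k; apply: conn_trans kc (conn1 cd).
  by exists (g * h); rewrite actM; apply: conn_map hz => a b; apply: r_act.
have conn_r a b : conn r a b.
  have [g ga] : S a by rewrite ST.
  have [h hb] : S b by rewrite ST.
  by apply: conn_trans (conn_sym rC ga) (conn_trans (orb g h) hb).
(* [r] connects the whole tree, so it contains the edge it was built to avoid. *)
have /(_ 1)[_ + _] := conn_edge tX rX xy (conn_r x y).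
by rewrite !act1.
Qed.

End HalfTree.
End Tree.

(** * Cylinders of one tree *)

Section Cylinder.
Set Implicit Arguments.
Unset Strict Implicit.
Context {G : groupType} {E : set (set G)} {I : Type} {H : I -> set G}.
Context {R : set G -> set G -> Prop} (adm : admissible E H R).

(** Membership in [E] is built in because [R] is meaningful only there; this makes [equ] symmetric
    and transitive on all sets. *)
Definition equ (A B : set G) : Prop := [/\ E A, E B & R A B].

Lemma equ_sym A B : equ A B -> equ B A.
Proof. by move=> [EA EB AB]; split=> //; apply: (adm_sym adm). Qed.

Lemma equ_trans A B C : equ A B -> equ B C -> equ A C.
Proof. by move=> [EA EB AB] [_ EC BC]; split=> //; apply: (adm_trans adm) BC. Qed.

Lemma equ_sub A B : E A -> E B -> A `<=` B -> equ A B.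
Proof. by move=> EA EB AB; split=> //; apply: (adm_sub adm). Qed.

Section OneTree.
Context {T : minimal_Etree E H}.
Implicit Types (x y u w : T) (e : T * T) (Y : set (T * T)).

Let tT : is_tree T. Proof. exact: Gtree_tree. Qed.

Lemma edge_stab_E e : adj e.1 e.2 -> E (edge_stab e).
Proof. by case: e => u w; apply: minimal_Etree_E. Qed.

(** Any edge of a cylinder may serve as its representative. *)
Lemma cylinderP Y e e' : is_cylinder R Y -> Y e ->
  Y e' <-> adj e'.1 e'.2 /\ equ (edge_stab e) (edge_stab e').
Proof.
case=> e0 [ae0 ->] [ae Re]; have Ee := edge_stab_E ae.
have E0 := edge_stab_E ae0.
split=> [[ae' Re']|[ae' [_ Ee' Re']]]; split=> //.
  have Ee' := edge_stab_E ae'; split=> //.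
  exact: (adm_trans adm) (adm_sym adm _ _ Re) Re'.
exact: (adm_trans adm) Re Re'.
Qed.

Lemma cylinder_adj Y u w : is_cylinder R Y -> Y (u, w) -> adj u w.
Proof. by move=> cY Yuw; have [[]//] := cylinderP (u, w) cY Yuw. Qed.

Lemma cylinder_edge Y e e' : is_cylinder R Y -> Y e -> adj e'.1 e'.2 ->
  equ (edge_stab e) (edge_stab e') -> Y e'.
Proof. by move=> cY Ye ae' ee'; apply/(cylinderP _ cY Ye). Qed.

Lemma cylinder_equ Y e e' : is_cylinder R Y -> Y e -> Y e' ->
  equ (edge_stab e) (edge_stab e').
Proof. by move=> cY Ye /(cylinderP _ cY Ye)[]. Qed.

Lemma cylinder_eq Y Y' e e' : is_cylinder R Y -> is_cylinder R Y' ->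
  Y e -> Y' e' -> equ (edge_stab e) (edge_stab e') -> Y = Y'.
Proof.
move=> cY cY' Ye Ye' ee'; apply/seteqP; split=> a.
  move=> /(cylinderP _ cY Ye)[aa ea]; apply/(cylinderP _ cY' Ye'); split=> //.
  exact: equ_trans (equ_sym ee') ea.
move=> /(cylinderP _ cY' Ye')[aa ea]; apply/(cylinderP _ cY Ye); split=> //.
exact: equ_trans ee' ea.
Qed.

Lemma cylinder_rev Y u w : is_cylinder R Y -> Y (u, w) -> Y (w, u).
Proof.
move=> cY Yuw; have := Yuw; rewrite !(cylinderP _ cY Yuw).
by rewrite [edge_stab (w, u)]edge_stabC => -[/adj_sym].
Qed.

Lemma edge_in_cylinder e : adj e.1 e.2 ->
  exists Y, is_cylinder R Y /\ Y e.
Proof.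
move=> ae; exists (edge_class R e); split; first by exists e.
by split=> //; apply: (adm_refl adm); apply: edge_stab_E.
Qed.

Lemma cylinder_nonempty Y : is_cylinder R Y -> exists u w, Y (u, w).
Proof.
case=> [[u w] [uw ->]]; exists u, w; split=> //.
by apply: (adm_refl adm); apply: edge_stab_E.
Qed.

(** A vertex outside [V0] lies on only one cylinder, which therefore takes in every edge at that
    vertex. *)
Lemma in_cylinder_adj Y x y : is_cylinder R Y -> ~ is_V0 R x ->
  in_cylinder x Y -> adj x y -> Y (x, y) /\ in_cylinder y Y.
Proof.
move=> cY nV xY xy; have [Y' [cY' Y'xy]] := edge_in_cylinder (e := (x, y)) xy.
suff YY' : Y = Y' by rewrite YY'; split=> //; exists x; apply: cylinder_rev.
apply: contrapT => YY'; apply: nV; left; exists Y, Y'; split=> //.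
by exists y.
Qed.

(** Axiom (iii) for two edge stabilizers, each fixing the chosen endpoint of its edge. *)
Lemma segment_equ x x' y y' s e : walk (@adj G T) x s -> reduced x s ->
  last x s = y -> adj x x' -> adj y y' ->
  equ (edge_stab (x, x')) (edge_stab (y, y')) ->
  traverses x s e -> equ (edge_stab (x, x')) (edge_stab e).
Proof.
move=> ws rs ls xx' yy' [E1 E2 e12] es.
have fx : fixes (edge_stab (x, x')) x by move=> g [].
have fy : fixes (edge_stab (y, y')) y by move=> g [].
have ae : adj e.1 e.2 by move/walkP: ws; apply.
have Ee := edge_stab_E ae; split=> //; apply: (adm_sym adm) => //.
by have [] := adm_segment adm (@minimal_Etree_E _ _ _ _ T)
  (@minimal_Etree_H _ _ _ _ T) E1 E2 e12 fx fy ws rs ls es.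
Qed.

(** Convexity of cylinders: all edges of the geodesic from [x] to [y] are equivalent to those of
    [Y]. *)
Lemma cylinder_conn Y x y : is_cylinder R Y -> in_cylinder x Y ->
  in_cylinder y Y -> conn (fun a b => Y (a, b)) x y.
Proof.
move=> cY [x' xY] [y' yY]; have [s [ws rs ls]] := tree_reduced x y tT.
exists s; split=> //; apply/walkP => -[a b] es /=.
apply: (cylinder_edge cY xY); first by move/walkP: ws => /(_ _ es).
have xx' := cylinder_adj cY xY; have yy' := cylinder_adj cY yY.
exact: segment_equ ws rs ls xx' yy' (cylinder_equ cY xY yY) es.
Qed.

(* If [Y] had a single vertex [x] in [V0], then [Y] would contain a half-tree
   based at [x], hence a translate of [x] other than [x]. *)
Lemma cylinder_two_V0 Y : is_cylinder R Y ->
  (forall e, adj e.1 e.2 -> Y e) \/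
  exists x x', [/\ x <> x', is_V0 R x, is_V0 R x',
    in_cylinder x Y & in_cylinder x' Y].
Proof.
move=> cY; case: (pselect (exists x, is_V0 R x /\ in_cylinder x Y)); last first.
  (* With no vertex in [V0], [Y] takes in all edges at each of its vertices and spreads over the
     whole tree. *)
  move=> /forallNP nV; left.
  have nVY x : in_cylinder x Y -> ~ is_V0 R x by move=> xY xV; apply: (nV x).
  have allY x : in_cylinder x Y.
    have [u [w Yuw]] := cylinder_nonempty cY.
    have uY : in_cylinder u Y by exists w.
    move: x; apply: (adj_connected_all tT uY) => x y xy xY.
    by have [] := in_cylinder_adj cY (nVY _ xY) xY xy.
  by move=> [x y] xy; have [] := in_cylinder_adj cY (nVY _ (allY x)) (allY x) xy.
move=> [x [xV xY]]; right; apply: contrapT => nx.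
have xuniq u : is_V0 R u -> in_cylinder u Y -> u = x.
  move=> uV uY; apply: contrapT => ux; apply: nx; exists x, u.
  by split=> // xu; apply: ux.
have [y Yxy] := xY; have xy := cylinder_adj cY Yxy.
have halfY z : half_tree x y z -> in_cylinder z Y.
  move=> hz; apply: (conn_ind hz (P := fun z => in_cylinder z Y)).
    by exists x; apply: cylinder_rev.
  move=> a b ha [ab _ _] aY.
  have aV : ~ is_V0 R a.
    by move=> aV; apply: (half_tree_src tT xy); rewrite -[X in half_tree x y X](xuniq a).
  by have [] := in_cylinder_adj cY aV aY ab.
have [g hg] := half_translate tT x (@minimal_Etree_min _ _ _ _ T) xy.
apply: (half_tree_src tT xy); rewrite -[X in half_tree x y X](xuniq (act g x)) //.
  exact: (is_V0_act adm).
exact: halfY.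
Qed.

End OneTree.

(** * Images of cylinders and of [V0] under an equivariant map *)

Section TwoTrees.
Context {T T' : minimal_Etree E H}.
Implicit Types (f : emap T T') (x y u w p q : T) (e : T * T) (Y : set (T * T)).

Let tT : is_tree T. Proof. exact: Gtree_tree. Qed.
Let tT' : is_tree T'. Proof. exact: Gtree_tree. Qed.

Lemma emap_nil f u w : adj u w -> emap_path f u w = [::] -> f u = f w.
Proof. by move=> uw fuw; rewrite -(emap_last f uw) fuw. Qed.

Lemma emap_traverses_adj f u w (e' : T' * T') : adj u w ->
  traverses (f u) (emap_path f u w) e' -> adj e'.1 e'.2.
Proof. by move=> /(emap_walk f)/walkP; apply. Qed.

(** An element fixing both ends of an edge maps its image path to itself, vertex by vertex. *)
Lemma emap_stab f u w (e' : T' * T') : adj u w -> traverses (f u) (emap_path f u w) e' ->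
  edge_stab (u, w) `<=` edge_stab e'.
Proof.
move=> uw e's g [/= gu gw]; apply: traverses_fixed e's.
  by rewrite -emap_equiv gu.
by rewrite -emap_path_equiv // gu gw.
Qed.

Lemma emap_equ f u w (e' : T' * T') : adj u w -> traverses (f u) (emap_path f u w) e' ->
  equ (edge_stab (u, w)) (edge_stab e').
Proof.
move=> uw e's; apply: equ_sub (emap_stab uw e's); apply: edge_stab_E => //.
exact: emap_traverses_adj e's.
Qed.

(** The vertices joined to the image by traversed edges form an invariant subtree, hence all of
    [T']. Traversed edges thus connect [T'], and [conn_edge] applies. *)
Lemma emap_surj f (e' : T' * T') : adj e'.1 e'.2 ->
  exists u w, adj u w /\ traverses (f u) (emap_path f u w) e'.
Proof.
case: e' => a' b' /= ab'.
pose r a b := exists u w, adj u w /\ traverses (f u) (emap_path f u w) (a, b).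
have rX a b : r a b -> adj a b.
  by move=> [u [w [uw /(emap_traverses_adj uw)]]].
have fconn u w : adj u w -> conn r (f u) (f w).
  move=> uw; exists (emap_path f u w); rewrite emap_last //; split=> //.
  by apply/walkP => -[a b] es; exists u, w.
(* Both directions are recorded because [r] consists of oriented edges. *)
pose S : set T' := [set z | exists u, conn r (f u) z /\ conn r z (f u)].
have allconn u w : conn r (f u) (f w).
  apply: (conn_ind (tree_conn u w tT) (P := fun w => conn r (f u) (f w))).
    exact: conn_refl.
  by move=> a b _ ab ua; apply: conn_trans ua (fconn _ _ ab).
have Sr a b : r a b -> S a -> S b.
  move=> [u [w [uw es]]] [v [va av]].
  exists v; split.
    by apply: conn_trans va (conn1 _); exists u, w.
  (* From [b], the rest of the path through [(a, b)] leads to [f w]. *)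
  apply: conn_trans (allconn w v).
  have wfu := emap_walk f uw; have lfu := emap_last f uw.
  have wr : walk r (f u) (emap_path f u w).
    by apply/walkP => -[c d] cds; exists u, w.
  rewrite -lfu; elim: (emap_path f u w) (f u) wr es {wfu lfu} => //= z s IH c.
  move=> [cz ws] [[_ ->]|es]; first by exists s.
  exact: IH.
have ST : S = setT.
  apply: (@minimal_Etree_min _ _ _ _ T') => [|g z [u [uz zu]]].
    split; first by have [[u _] _ _] := tT; exists (f u), u; split; apply: conn_refl.
    move=> a b Sa [w [wb _]]; have [u [_ ua]] := Sa.
    have [s [ws ls]] : conn r a b := conn_trans ua (conn_trans (allconn u w) wb).
    exists s; split=> //; apply: (@walk_mono _ (fun c d => r c d /\ S d)).
      by move=> c d [/rX].
    exact: walk_stable ws Sa Sr.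
  have r_act a b : r a b -> r (act g a) (act g b).
    move=> [v [w [vw es]]]; exists (act g v), (act g w); split; first exact: adj_act.
    by rewrite emap_equiv emap_path_equiv //; apply/traverses_map; exists (a, b).
  by exists (act g u); rewrite emap_equiv; split; apply: conn_map r_act _.
have [u [_ au]] : S a' by rewrite ST.
have [w [wb _]] : S b' by rewrite ST.
apply: (conn_edge tT' rX ab').
exact: conn_trans au (conn_trans (allconn u w) wb).
Qed.

(** Otherwise [f] would be constant on the half-tree and collapse every edge starting there. But
    some edge is not collapsed, and a translate of it starts in the half-tree. *)
Lemma emap_half f x y : (exists u' w' : T', adj u' w') -> adj x y ->
  emap_path f x y = [::] ->
  exists p q, [/\ half_tree x y p, adj p q, f p = f x & emap_path f p q <> [::]].
Proof.
move=> [u' [w' uw']] xy fxy; apply: contrapT => nex.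
have fhalf p : half_tree x y p -> f p = f x.
  move=> hp; apply: (conn_ind hp (P := fun p => f p = f x)).
    by rewrite (emap_nil xy).
  move=> a b ha [ab _ _] fa; rewrite -fa; apply/esym/emap_nil => //.
  by apply: contrapT => fab; apply: nex; exists a, b.
have nilhalf p q : half_tree x y p -> adj p q -> emap_path f p q = [::].
  move=> hp pq; apply: contrapT => fpq; apply: nex; exists p, q.
  by split=> //; apply: fhalf.
have [u [w [uw es]]] := emap_surj f (e' := (u', w')) uw'.
have [g hg] := half_translate tT u (@minimal_Etree_min _ _ _ _ T) xy.
have := nilhalf _ _ hg (adj_act g uw); rewrite emap_path_equiv //.
by case: (emap_path f u w) es.
Qed.

Lemma path_first f p q : adj p q -> emap_path f p q <> [::] ->
  exists b, traverses (f p) (emap_path f p q) (f p, b).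
Proof. by case: (emap_path f p q) => // b s _ _; exists b; left. Qed.

Definition collapses f Y : Prop := forall u w, Y (u, w) -> emap_path f u w = [::].

Lemma collapsed_V0 f x Y : (exists u' w' : T', adj u' w') -> is_cylinder R Y ->
  collapses f Y -> in_cylinder x Y -> is_V0 R (f x).
Proof.
move=> eT' cY Ynil [y Yxy]; have xy := cylinder_adj cY Yxy.
have Yyx := cylinder_rev cY Yxy; have yx := adj_sym xy.
have [p [q [hp pq fp npq]]] := emap_half eT' xy (Ynil _ _ Yxy).
have [p' [q' [hp' pq' fp' npq']]] := emap_half eT' yx (Ynil _ _ Yyx).
have [b tb] := path_first pq npq; have [b' tb'] := path_first pq' npq'.
have ab := emap_traverses_adj pq tb; have ab' := emap_traverses_adj pq' tb'.
have [Z [cZ Zb]] := edge_in_cylinder ab.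
have [Z' [cZ' Zb']] := edge_in_cylinder ab'.
rewrite fp in Zb; rewrite fp' -(emap_nil xy (Ynil _ _ Yxy)) in Zb'.
left; exists Z, Z'; split=> //; [|by exists b|by exists b'].
move=> ZZ'; rewrite -ZZ' in Zb'; apply: npq; apply: (Ynil p q).
have pp' : equ (edge_stab (p, q)) (edge_stab (p', q')).
  apply: equ_trans (emap_equ pq tb) (equ_trans _ (equ_sym (emap_equ pq' tb'))).
  rewrite fp fp' -(emap_nil xy (Ynil _ _ Yxy)); exact: cylinder_equ cZ Zb Zb'.
(* The geodesic from [p] to [p'] crosses [(y, x)], so [(p, q)] would belong to [Y] and be
   collapsed. *)
have [s [ws rs ls]] := tree_reduced p p' tT.
apply: (cylinder_edge cY Yyx) => //; apply: equ_sym.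
apply: (segment_equ ws rs ls pq pq' pp').
by apply: half_crossing => //; rewrite ls.
Qed.

(** The point is that the image of [Y] has an edge starting exactly at [f x]. If not, [f] would
    remain equal to [f x] along the connected set [Y] and collapse it. *)
Lemma not_collapses f Y x : is_cylinder R Y -> ~ collapses f Y ->
  in_cylinder x Y -> exists p q b,
    Y (p, q) /\ traverses (f p) (emap_path f p q) (f x, b).
Proof.
move=> cY nc xY; apply: contrapT => nex; apply: nc => u w Yuw.
have stay p q : f p = f x -> Y (p, q) -> emap_path f p q = [::].
  move=> fp Ypq; apply: contrapT => npq.
  have [b tb] := path_first (cylinder_adj cY Ypq) npq.
  by apply: nex; exists p, q, b; rewrite -fp.
apply: (stay) => //.
have xu : conn (fun a b => Y (a, b)) x u.
  by apply: cylinder_conn => //; exists w.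
apply: (conn_ind xu (P := fun p => f p = f x)) => // a b _ Yab fa.
rewrite -fa; apply/esym/emap_nil; last exact: stay.
exact: cylinder_adj cY Yab.
Qed.

Definition emap_image f Y : set (T' * T') :=
  [set e' | exists u w, Y (u, w) /\ traverses (f u) (emap_path f u w) e'].

(** Traversed edges are equivalent to their sources, so the image lies in one class. It fills the
    class because every edge of [T'] is traversed. *)
Lemma image_cylinder f Y : is_cylinder R Y -> ~ collapses f Y ->
  is_cylinder R (emap_image f Y).
Proof.
move=> cY /existsNP[u /existsNP[w /not_implyP[Yuw nuw]]].
have uw := cylinder_adj cY Yuw; have [b tb] := path_first uw nuw.
exists (f u, b); split; first exact: emap_traverses_adj tb.
apply/seteqP; split=> e'.
  move=> [v [z [Yvz te']]]; have vz := cylinder_adj cY Yvz.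
  split; first exact: emap_traverses_adj te'.
  suff [_ _ //] : equ (edge_stab (f u, b)) (edge_stab e').
  apply: equ_trans (equ_sym (emap_equ uw tb)) (equ_trans _ (emap_equ vz te')).
  exact: cylinder_equ cY Yuw Yvz.
move=> [ae' Re']; have [v [z [vz te']]] := emap_surj f ae'.
exists v, z; split=> //; apply: (cylinder_edge cY Yuw) => //.
apply: equ_trans (emap_equ uw tb) (equ_trans _ (equ_sym (emap_equ vz te'))).
by split=> //; apply: edge_stab_E => //; apply: emap_traverses_adj tb.
Qed.

Lemma no_edge_emap f : (forall u w : T, ~ adj u w) -> forall u' w' : T', ~ adj u' w'.
Proof.
move=> nT u' w' uw'; have [u [w [uw _]]] := emap_surj f (e' := (u', w')) uw'.
exact: nT uw.
Qed.

(** If one of the two cylinders at [x] is collapsed, [collapsed_V0] applies. Otherwise their images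
    are distinct, since two edges traversing a common edge are equivalent. *)
Lemma emap_V0 f x : is_V0 R x -> is_V0 R (f x).
Proof.
case: (pselect (exists u' w' : T', adj u' w')) => [eT'|]; last first.
  by move=> /forallNP nT' _; right=> u' w' uw'; apply: (nT' u'); exists w'.
case=> [[Y [Y' [cY cY' YY' xY xY']]]|/(no_edge_emap f)]; last by right.
case: (pselect (collapses f Y)) => [nY|nY]; first exact: (collapsed_V0 eT' cY).
case: (pselect (collapses f Y')) => [nY'|nY']; first exact: (collapsed_V0 eT' cY').
left; exists (emap_image f Y), (emap_image f Y'); split; try exact: image_cylinder.
- move=> im; apply: YY'; have [p [q [b [Ypq tb]]]] := not_collapses cY nY xY.
  have : emap_image f Y (f x, b) by exists p, q.
  rewrite im => -[p' [q' [Ypq' tb']]].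
  apply: (cylinder_eq cY cY' Ypq Ypq').
  apply: equ_trans (emap_equ (cylinder_adj cY Ypq) tb) (equ_sym _).
  exact: emap_equ (cylinder_adj cY' Ypq') tb'.
- by have [p [q [b pqb]]] := not_collapses cY nY xY; exists b, p, q.
- by have [p [q [b pqb]]] := not_collapses cY' nY' xY'; exists b, p, q.
Qed.

Lemma emap_eq_V0 f f' x : is_V0 R x -> f x = f' x.
Proof.
case=> [[Y [Y' [cY cY' YY' [w xw] [w' xw']]]]|nT]; last first.
  apply: (no_edge_point tT'); exact: no_edge_emap.
apply: contrapT => ff'; apply: YY'.
have [s [ws rs ls]] := tree_reduced (f x) (f' x) tT'.
case: s ws rs ls => [|b s] ws rs ls; first exact: False_ind (ff' ls).
have ab : adj (f x) b by case: ws.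
have sub g : act g x = x -> edge_stab (f x, b) g.
  move=> gx; have fx : act g (f x) = f x by rewrite -emap_equiv gx.
  have fx' : act g (f' x) = f' x by rewrite -emap_equiv gx.
  apply: (traverses_fixed fx (reduced_walk_fixed tT' ws rs ls fx fx')).
  by left.
(* The stabilizer of [x] need not lie in [E], so each edge stabilizer at [x] is compared directly
   with that of [(f x, b)]. *)
have equb z Z : is_cylinder R Z -> Z (x, z) ->
    equ (edge_stab (x, z)) (edge_stab (f x, b)).
  move=> cZ Zxz; apply: equ_sub => [||g [gx _]]; last exact: sub.
    by apply: edge_stab_E; apply: cylinder_adj Zxz.
  exact: edge_stab_E.
apply: (cylinder_eq cY cY' xw xw').
exact: equ_trans (equb _ _ cY xw) (equ_sym (equb _ _ cY' xw')).
Qed.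

End TwoTrees.
End Cylinder.

(** * Constructing equivariant maps within a deformation space *)

Section EquivariantMap.
Set Implicit Arguments.
Unset Strict Implicit.
Context {G : groupType}.
Implicit Types X Y : Ggraph G.

Lemma subgroup_stab X (v : X) : subgroup [set g | act g v = v].
Proof.
split=> [|g h gv hv|g gv] /=; first exact: act1.
  by rewrite actM hv.
by rewrite -[in LHS]gv actK.
Qed.

(** Send one representative of each vertex orbit to a point fixed by its stabilizer, which is
    elliptic in [Y], and extend by translation. *)
Lemma equivariant_exists X Y : is_tree X -> same_deformation_space X Y ->
  exists f : X -> Y, equivariant f.
Proof.
move=> [[v0 _] _ _] XY.
have ex_p : forall v : X, exists y : Y, forall g, act g v = v -> act g y = y.
  move=> v; suff [y] : elliptic Y [set g | act g v = v] by exists y.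
  by apply/(XY _ (subgroup_stab v)); exists v.
have [p pP] := boolp.choice ex_p.
(* The representative depends only on the orbit as a set; [v0] is a default value for the empty
   set. *)
have ex_c : forall O : set X, exists v, O !=set0 -> O v.
  move=> O; case: (pselect (O !=set0)) => [[v Ov]|nO]; first by exists v.
  by exists v0.
have [c cP] := boolp.choice ex_c.
pose orbit v : set X := [set w | exists g, act g v = w].
have orbit_act g v : orbit (act g v) = orbit v.
  apply/seteqP; split=> w [k <-]; first by exists (k * g); rewrite actM.
  by exists (k * g^-1); rewrite actM actK.
have ex_k : forall v : X, exists k, act k (c (orbit v)) = v.
  move=> v; have [g gv] : orbit v (c (orbit v)) by apply: cP; exists v, 1; apply: act1.
  by exists g^-1; rewrite -gv actK.
have [k kP] := boolp.choice ex_k.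
exists (fun v => act (k v) (p (c (orbit v)))) => g v /=.
have kgv := kP (act g v); rewrite orbit_act in kgv *.
(* This element stabilizes the representative, so it fixes the chosen image point; that is the
   equivariance relation. *)
have := pP (c (orbit v)) ((k v)^-1 * g^-1 * k (act g v)).
rewrite !actM kgv actK -[X in act (k v)^-1 X](kP v) actK => /(_ erefl) fixp.
by rewrite -[in RHS]fixp !actVK.
Qed.

(** Edges go to geodesics, whose uniqueness gives compatibility with reversal and with the
    action. *)
Lemma emap_of_equivariant X Y (f : X -> Y) : is_tree Y -> equivariant f ->
  exists F : emap X Y, F =1 f.
Proof.
move=> tY fE; have [_ _ uY] := tY.
have ex_q : forall uw : X * X, exists s, [/\ walk (@adj G Y) (f uw.1) s,
    reduced (f uw.1) s & last (f uw.1) s = f uw.2] by move=> uw; apply: tree_reduced.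
have [q qP] := boolp.choice ex_q.
have q_uniq u w s : walk (@adj G Y) (f u) s -> reduced (f u) s ->
    last (f u) s = f w -> q (u, w) = s.
  by have [/= ? ? ?] := qP (u, w) => ? ? ls; apply: (uY (f u)) => //; rewrite ls.
unshelve eexists (@Build_emap G X Y f (fun u w => q (u, w)) fE _ _ _ _) => //.
- by move=> u w _; have [] := qP (u, w).
- by move=> u w _; have [] := qP (u, w).
- move=> u w _; have [/= wq rq lq] := qP (u, w).
  have [t [qt wt lt]] := walk_rev (@adj_sym G Y) wq.
  rewrite qt lq; congr (_ :: _); rewrite lq in qt wt lt.
  by apply: q_uniq => //; apply: reduced_rev rq.
- move=> g u w _; have [/= wq rq lq] := qP (u, w).
  apply: q_uniq; rewrite fE.
  + by apply: walk_map wq => a b; apply: adj_act.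
  + by apply: reduced_map rq; apply: act_inj.
  + by rewrite last_map lq fE.
Qed.

Lemma deformation_emap X Y : is_tree X -> is_tree Y ->
  same_deformation_space X Y -> exists f : emap X Y, True.
Proof.
move=> tX tY /(equivariant_exists tX)[f fE].
by have [F _] := emap_of_equivariant tY fE; exists F.
Qed.

Lemma same_deformation_sym X Y :
  same_deformation_space X Y -> same_deformation_space Y X.
Proof. by move=> XY A sA; rewrite XY. Qed.

Lemma traverses_cat {X : Type} (u : X) s t e :
  traverses u (s ++ t) e <-> traverses u s e \/ traverses (last u s) t e.
Proof.
elim: s u => [|w s IH] u /=; first by tauto.
by rewrite IH; tauto.
Qed.

Lemma traverses_map_path X Y (g : emap X Y) u s e : walk (@adj G X) u s ->
  traverses (g u) (map_path g u s) e <->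
  exists a b, traverses u s (a, b) /\ traverses (g a) (emap_path g a b) e.
Proof.
elim: s u => [|w s IH] u /=; first by split=> // -[a [b []]].
move=> [uw ws]; rewrite traverses_cat emap_last // IH //; split.
  case=> [t|[a [b [abs t]]]]; first by exists u, w; split=> //; left.
  by exists a, b; split=> //; right.
by move=> [a [b [[[-> ->]|abs] t]]]; [left|right; exists a, b].
Qed.

End EquivariantMap.

(** * The relation between trees of cylinders induced by a map *)

Section Induced.
Set Implicit Arguments.
Unset Strict Implicit.
Context {G : groupType} {E : set (set G)} {I : Type} {H : I -> set G}.
Context {R : set G -> set G -> Prop} (adm : admissible E H R).
Implicit Types T : minimal_Etree E H.

(** A pointwise form of [induced_by]. Since it determines [b] from [a], identities between induced
    maps reduce to checking this relation. *)
Definition induced_at T T' (f : emap T T') (a : Tc adm T) (b : Tc adm T') : Prop :=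
  match a with
  | inl x => exists x' : V0 R T', b = inl x' /\ sval x' = f (sval x)
  | inr Y => match b with
             | inl x' => forall u w, sval Y (u, w) ->
                 f u = sval x' /\ emap_path f u w = [::]
             | inr Y' => forall e', sval Y' e' <-> emap_image f (sval Y) e'
             end
  end.

Lemma V0_eq T (x x' : V0 R T) : sval x = sval x' -> x = x'.
Proof. by case: x x' => [x ?] [x' ?] /= xx'; apply: eq_exist. Qed.

Lemma cylinder_val_eq T (Y Y' : cylinder R T) : sval Y = sval Y' -> Y = Y'.
Proof. by case: Y Y' => [Y ?] [Y' ?] /= YY'; apply: eq_exist. Qed.

Lemma collapses_const T T' (f : emap T T') Y x y : is_cylinder R Y ->
  collapses f Y -> in_cylinder x Y -> in_cylinder y Y -> f x = f y.
Proof.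
move=> cY nY xY yY; have xy := cylinder_conn adm cY xY yY.
apply: (conn_ind xy (P := fun z => f x = f z)) => // a b _ Yab ->.
by apply: emap_nil (nY _ _ Yab); apply: cylinder_adj cY Yab.
Qed.

Lemma induced_at_exists T T' (f : emap T T') a : exists b, induced_at f a b.
Proof.
case: a => [[x xV]|[Y cY]] /=.
  by exists (inl (exist _ (f x) (emap_V0 adm f xV))), (exist _ (f x) (emap_V0 adm f xV)).
case: (pselect (collapses f Y)) => nY; last first.
  by exists (inr (exist _ _ (image_cylinder adm cY nY))).
have [u [w Yuw]] := cylinder_nonempty adm cY.
have uY : in_cylinder u Y by exists w.
have fuV : is_V0 R (f u).
  case: (pselect (exists u' w' : T', adj u' w')) => [eT'|/forallNP nT'].
    exact: (collapsed_V0 adm eT' cY).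
  by right=> u' w' uw'; apply: (nT' u'); exists w'.
exists (inl (exist _ (f u) fuV)) => p q Ypq; split; last exact: nY.
by apply: collapses_const cY nY _ uY; exists q.
Qed.

Lemma induced_at_uniq T T' (f : emap T T') a b b' :
  induced_at f a b -> induced_at f a b' -> b = b'.
Proof.
case: a => [x [y [-> yx]] [y' [-> yx']]|[Y cY]].
  by congr inl; apply: V0_eq; rewrite yx.
have [u [w Yuw]] := cylinder_nonempty adm cY.
(* A cylinder is nonempty, so it cannot be the image of a collapsed one. *)
have incompatible (x' : T') (Y' : cylinder R T') :
    (forall u w, Y (u, w) -> f u = x' /\ emap_path f u w = [::]) ->
    (forall e', sval Y' e' <-> emap_image f Y e') -> False.
  move=> nY YY'; have [p [q Ypq]] := cylinder_nonempty adm (svalP Y').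
  by have /YY'[v [z [/nY[_ ->]]]] := Ypq.
case: b b' => [x|Y1] [x'|Y2] //= h h'.
- by congr inl; apply: V0_eq; have [<- _] := h _ _ Yuw; have [<- _] := h' _ _ Yuw.
- by have [] := incompatible _ _ h h'.
- by have [] := incompatible _ _ h' h.
- congr inr; apply: cylinder_val_eq; apply/seteqP.
  by split=> e; [move/h/h' | move/h'/h].
Qed.

Lemma induced_at_act T T' (f : emap T T') g a b :
  induced_at f a b -> induced_at f (act g a) (act g b).
Proof.
case: a => [[x xV] [y [-> yx]]|[Y cY]] /=.
  by eexists; split; first reflexivity; rewrite /= yx emap_equiv.
case: b => [[x' xV'] /= h _ _ [[u w] /= Yuw [<- <-]]|[Y' cY'] /= h e'].
  have [fu fuw] := h _ _ Yuw.
  by rewrite emap_equiv fu emap_path_equiv ?fuw //; apply: cylinder_adj cY Yuw.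
split=> [[e /h[u [w [Yuw ue]]] <-]|[_ [_ [[[u w] /= Yuw [<- <-]]]]]].
  exists (act g u), (act g w); split; first by exists (u, w).
  rewrite emap_equiv emap_path_equiv; last exact: cylinder_adj cY Yuw.
  by apply/traverses_map; exists e.
rewrite emap_equiv emap_path_equiv; last exact: cylinder_adj cY Yuw.
by move=> /traverses_map[e ue ->]; exists e => //; apply/h; exists u, w.
Qed.

(** If the cylinder is collapsed, the edge goes to a vertex; otherwise [not_collapses] gives an edge
    of the image cylinder at the image point. *)
Lemma induced_at_adj T T' (f : emap T T') a a' b b' :
  induced_at f a b -> induced_at f a' b' -> adj a a' -> adj b b' \/ b = b'.
Proof.
wlog : a a' b b' / exists x Y, a = inl x /\ a' = inr Y.
  move=> wl; case: a a' => [x|Y] [x'|Y'] // fa fa' aa'.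
    by apply: wl fa fa' aa'; exists x, Y'.
  case: (wl _ _ _ _ _ fa' fa (adj_sym aa')) => [|/adj_sym|]; last by right.
    by exists x', Y.
  by left.
move=> [x [[Y cY] [-> ->]]] [y [-> yx]] + /= xY.
case: b' => [x' /= h|Y' /= h].
  right; congr inl; apply: V0_eq; case: xY => w xY.
  by rewrite yx; have [<-] := h _ _ xY.
left; rewrite /= yx; have [p [q Y'pq]] := cylinder_nonempty adm (svalP Y').
have /h[u [w [Yuw puw]]] := Y'pq.
have nY : ~ collapses f Y by move=> /(_ _ _ Yuw) fuw; rewrite fuw in puw.
have [v [z [d [Yvz t]]]] := not_collapses adm cY nY xY.
by exists d; apply/h; exists v, z.
Qed.

Lemma induced_at_id T a : induced_at (emap_id T) a a.
Proof.
case: a => [x|[Y cY]] /=; first by exists x.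
move=> [u w]; split=> [Yuw|[a [b [Yab /= [->|]]]]] //.
by exists u, w; split=> //; left.
Qed.

Lemma induced_at_comp T T' T'' (g : emap T' T'') (f : emap T T') a b c :
  induced_at f a b -> induced_at g b c -> induced_at (emap_comp g f) a c.
Proof.
case: a => [x [y [-> yx]] [z [-> zy]]|[Y cY]]; first by exists z; rewrite zy yx.
case: b => [x' /= h [z [-> zx']]|[Y' cY'] /= h] /=.
  by move=> u w /h[-> ->]; rewrite zx'.
case: c => [z gz u w Yuw|Z gZ e].
  have uw := cylinder_adj adm cY Yuw; split; last first.
    (* The path of the composite concatenates the [g]-paths of edges of [Y'], all empty as [g]
       collapses [Y']. *)
    have : forall e, traverses (f u) (emap_path f u w) e -> Y' e.
      by move=> e ue; apply/h; exists u, w.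
    elim: (emap_path f u w) (f u) => //= v s IH p Y's.
    have [_ ->] : g p = sval z /\ emap_path g p v = [::].
      by apply: gz; apply: Y's; left.
    by apply: IH => e ve; apply: Y's; right.
  (* This provides an edge of [Y'] starting at [f u], where [gz] gives the value of [g]. *)
  have nY : ~ collapses f Y.
    move=> nY; have [p [q /h[v [z' [/nY ->]]]]] // := cylinder_nonempty adm cY'.
  have [p [q [b [Ypq t]]]] := not_collapses adm cY nY (ex_intro _ w Yuw).
  by have [] := gz (f u) b _; first by apply/h; exists p, q.
rewrite gZ; split=> [[p [q [/h[u [w [Yuw upq]]] te]]]|[u [w [Yuw te]]]].
  exists u, w; split=> //; have uw := cylinder_adj adm cY Yuw.
  by apply/(traverses_map_path g _ (emap_walk f uw)); exists p, q.
have uw := cylinder_adj adm cY Yuw.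
have [p [q [upq pqe]]] := (traverses_map_path g e (emap_walk f uw)).1 te.
by exists p, q; split=> //; apply/h; exists u, w.
Qed.

(** The return map [h] makes [f] injective on [V0], so [Y] cannot contain two such vertices. Then
    [Y] contains all edges and [f] traverses none. *)
Lemma collapses_point T T' (f : emap T T') (h : emap T' T) Y :
  is_cylinder R Y -> collapses f Y -> forall u' w' : T', ~ adj u' w'.
Proof.
move=> cY nY u' w' uw'.
case: (cylinder_two_V0 adm cY) => [allY|[x [x' [xx' xV xV' xY xY']]]].
  have [u [w [uw]]] := emap_surj f (e' := (u', w')) uw'.
  by rewrite (nY _ _ (allY (u, w) uw)).
apply: xx'; have hf z : is_V0 R z -> h (f z) = z.
  exact: (emap_eq_V0 adm (emap_comp h f) (emap_id T)).
by rewrite -(hf _ xV) (collapses_const cY nY xY xY') hf.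
Qed.

Lemma induced_at_eq T T' (f f' : emap T T') (h : emap T' T) a b b' :
  induced_at f a b -> induced_at f' a b' -> b = b'.
Proof.
case: a => [x [y [-> yx]] [y' [-> yx']]|[Y cY]].
  congr inl; apply: V0_eq; rewrite yx yx'.
  by apply: (emap_eq_V0 adm); apply: svalP.
have point (c c' : Tc adm T') : (forall u' w' : T', ~ adj u' w') -> c = c'.
  move=> nT'; have nocyl (Z : cylinder R T') : False.
    have [u [w Zuw]] := cylinder_nonempty adm (svalP Z).
    by apply: (nT' u w); apply: cylinder_adj (svalP Z) Zuw.
  case: c c' => [x|Z] [x'|Z']; try by exfalso; apply: nocyl.
  by congr inl; apply: V0_eq; apply: no_edge_point nT' _ _; apply: Gtree_tree.
case: b b' => [x|Y1] b' fb fb'.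
  by apply/point/(collapses_point h cY (f := f)) => u w /fb[].
case: b' fb' => [x'|Y2] fb'.
  by apply/point/(collapses_point h cY (f := f')) => u w /fb'[].
(* Each image cylinder contains an edge traversed by the image of an edge of [Y], and these are all
   equivalent. *)
congr inr; apply: cylinder_val_eq.
have [u1 [w1 Y1e]] := cylinder_nonempty adm (svalP Y1).
have [u2 [w2 Y2e]] := cylinder_nonempty adm (svalP Y2).
apply: (cylinder_eq adm (svalP Y1) (svalP Y2) Y1e Y2e).
have /fb[p [q [Ypq t]]] := Y1e; have /fb'[p' [q' [Ypq' t']]] := Y2e.
have pq := cylinder_adj adm cY Ypq; have pq' := cylinder_adj adm cY Ypq'.
apply: (equ_trans adm (equ_sym adm (emap_equ adm pq t))).
apply: (equ_trans adm _ (emap_equ adm pq' t')).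
exact: (cylinder_equ adm cY).
Qed.

End Induced.

(** * Assembling the functor and the canonical isomorphisms *)

Theorem theorem1 (G : groupType) (hG : finitely_generated G)
    (E : set (set G)) (hE : subgroup_class E) (hEconj : conj_invariant E)
    (I : Type) (H : I -> set G) (hH : forall i, subgroup (H i))
    (R : set G -> set G -> Prop) (adm : admissible E H R) :
  exists (Phi : forall T T' : minimal_Etree E H,
             same_deformation_space T T' -> Tc adm T -> Tc adm T')
         (F : forall T T' : minimal_Etree E H,
             emap T T' -> Tc adm T -> Tc adm T'),
    (* (1) *)
    [/\ forall (T T' : minimal_Etree E H) (h : same_deformation_space T T'),
          graph_iso (Phi T T' h) /\ equivariant (Phi T T' h),
        forall (T : minimal_Etree E H) (h : same_deformation_space T T), Phi T T h =1 id,
        forall (T T' T'' : minimal_Etree E H) (h : same_deformation_space T T')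
            (h' : same_deformation_space T' T'')
            (h'' : same_deformation_space T T''),
          Phi T T'' h'' =1 Phi T' T'' h' \o Phi T T' h
      & forall (T T' : minimal_Etree E H) (h : same_deformation_space T T') (f : emap T T'),
          Phi T T' h =1 F T T' f] /\
    (* (2) *)
    [/\ forall (T T' : minimal_Etree E H) (f : emap T T'),
          [/\ cellular (F T T' f), equivariant (F T T' f)
            & induced_by f (F T T' f)],
        forall T : minimal_Etree E H, F T T (emap_id T) =1 id
      & forall (T T' T'' : minimal_Etree E H) (f : emap T T') (g : emap T' T''),
          F T T'' (emap_comp g f) =1 F T' T'' g \o F T T' f].
Proof.
pose F (T T' : minimal_Etree E H) (f : emap T T') (a : Tc adm T) :=
  projT1 (cid (induced_at_exists f a)).
have FP (T T' : minimal_Etree E H) (f : emap T T') (a : Tc adm T) :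
    induced_at f a (F T T' f a).
  exact: (projT2 (cid (induced_at_exists f a))).
have emapP (T T' : minimal_Etree E H) :
    same_deformation_space T T' -> exists f : emap T T', True.
  by apply: deformation_emap; apply: Gtree_tree.
pose Phi (T T' : minimal_Etree E H) (h : same_deformation_space T T') :=
  F T T' (projT1 (cid (emapP T T' h))).
(* Independence of the chosen map, from which the coherence of [Phi] follows. *)
have PhiF (T T' : minimal_Etree E H) h f : Phi T T' h =1 F T T' f.
  move=> a; have [k _] := emapP _ _ (same_deformation_sym h).
  exact: (induced_at_eq k (FP _ _ _ a) (FP _ _ f a)).
have Fcell (T T' : minimal_Etree E H) f : cellular (F T T' f).
  by move=> a a'; apply: induced_at_adj.
have Fequiv (T T' : minimal_Etree E H) f : equivariant (F T T' f).
  by move=> g a; apply: induced_at_uniq (FP _ _ _ _) (induced_at_act g (FP _ _ _ _)).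
have Fid (T : minimal_Etree E H) : F T T (emap_id T) =1 id.
  by move=> a; apply: induced_at_uniq (FP _ _ _ _) (induced_at_id a).
have Fcomp (T T' T'' : minimal_Etree E H) f g :
    F T T'' (emap_comp g f) =1 F T' T'' g \o F T T' f.
  by move=> a; apply: induced_at_uniq (FP _ _ _ _) (induced_at_comp (FP _ _ _ _) (FP _ _ _ _)).
(* The round trip is induced by a map from [T] to itself, hence agrees with the map induced by the
   identity. *)
have PhiK (T T' : minimal_Etree E H) h h' : cancel (Phi T T' h) (Phi T' T h').
  move=> a; have [f _] := emapP _ _ h; have [f' _] := emapP _ _ h'.
  rewrite (PhiF _ _ h f) (PhiF _ _ h' f') -[LHS]/((F _ _ f' \o F _ _ f) a) -Fcomp.
  have hT : same_deformation_space T T by [].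
  by rewrite -(PhiF _ _ hT) (PhiF _ _ hT (emap_id T)) Fid.
exists Phi, F; split; split=> //.
- move=> T T' h; have h' := same_deformation_sym h.
  split; last by move=> g a; rewrite /Phi Fequiv.
  split; first by exists (Phi T' T h'); apply: PhiK.
  (* A cellular injection cannot collapse an edge. *)
  have cellP S S' k (a a' : Tc adm S) : adj a a' -> adj (Phi S S' k a) (Phi S S' k a').
    move=> aa'; case: (Fcell _ _ (projT1 (cid (emapP S S' k))) _ _ aa') => // eqa.
    have k' := same_deformation_sym k.
    have aa : a = a' by rewrite -(PhiK _ _ k k' a) /Phi eqa; apply: PhiK.
    by case: (@adj_irr _ _ a'); rewrite -[X in adj X _]aa.
  move=> a a'; split; first exact: cellP.
  by move=> /(cellP _ _ h'); rewrite !PhiK.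
- by move=> T h a; rewrite (PhiF _ _ h (emap_id T)) Fid.
- move=> T T' T'' h h' h'' a; have [f _] := emapP _ _ h; have [f' _] := emapP _ _ h'.
  by rewrite (PhiF _ _ h'' (emap_comp f' f)) Fcomp /= (PhiF _ _ h f) (PhiF _ _ h' f').
- move=> T T' f; split=> //; split=> [x|Y]; first exact: FP _ _ f (inl x).
  exact: FP _ _ f (inr Y).
Qed.
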